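(* Let $0<l_2\le l_1$ be real numbers and put $\angle B_{\max}=2\arctan(l_2/l_1)$. If $0<\theta<\angle B_{\max}$, then there exists a unique triangle $ABC$ with $l_a=l_2$, $l_b=l_1$ and $\angle B=\theta$. If $\theta$ does not lie in this interval, no such triangle exists.
   Context: For a non-degenerate triangle $ABC$ in the Euclidean plane, $\angle A,\angle B,\angle C$ are its interior angles; $l_a$ and $l_b$ denote the lengths of the internal angle bisectors drawn from $A$ and $B$ respectively, measured from the vertex to the opposite side. Uniqueness of triangles is understood up to congruence respecting the vertex labels. *)

(* Defs.v *)
From Stdlib Require Import Reals.
Open Scope R_scope.

Definition point : Type := (R * R)%type.

Definition pdist (P Q : point) : R :=
  dist_euc (fst P) (snd P) (fst Q) (snd Q).

Definition collinear (P Q S : point) : Prop :=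
  exists a b c : R, (a <> 0 \/ b <> 0) /\
    a * fst P + b * snd P + c = 0 /\
    a * fst Q + b * snd Q + c = 0 /\
    a * fst S + b * snd S + c = 0.

(* Unoriented angle PVQ at the vertex V, in [0, PI]; meaningful for P <> V and
   Q <> V. *)
Definition angle (P V Q : point) : R :=
  acos (((fst P - fst V) * (fst Q - fst V) + (snd P - snd V) * (snd Q - snd V))
        / (pdist V P * pdist V Q)).

Definition on_segment (P Q D : point) : Prop :=
  exists t : R, 0 <= t <= 1 /\
    fst D = (1 - t) * fst P + t * fst Q /\
    snd D = (1 - t) * snd P + t * snd Q.

Record plane_triangle : Type := PlaneTriangle {
  vA : point;
  vB : point;
  vC : point;
  nondegenerate : ~ collinear vA vB vC
}.

Definition angle_B (T : plane_triangle) : R := angle (vA T) (vB T) (vC T).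

Definition bisector_foot (V P Q D : point) : Prop :=
  on_segment P Q D /\ angle P V D = angle D V Q.

(* The foot D is unique when V, P, Q are not collinear, so at most one l
   satisfies this relation. *)
Definition bisector_length (V P Q : point) (l : R) : Prop :=
  exists D : point, bisector_foot V P Q D /\ pdist V D = l.

Definition is_l_a (T : plane_triangle) (l : R) : Prop :=
  bisector_length (vA T) (vB T) (vC T) l.

Definition is_l_b (T : plane_triangle) (l : R) : Prop :=
  bisector_length (vB T) (vC T) (vA T) l.

Definition isometry (f : point -> point) : Prop :=
  forall P Q : point, pdist (f P) (f Q) = pdist P Q.

(* Reflections are allowed, and vertices correspond according to their labels. *)
Definition congruent (T T' : plane_triangle) : Prop :=
  exists f : point -> point, isometry f /\
    f (vA T) = vA T' /\ f (vB T) = vB T' /\ f (vC T) = vC T'.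

Definition angle_B_max (l1 l2 : R) : R := 2 * atan (l2 / l1).

(* Main.v *)
Require Import Defs.
From Stdlib Require Import Reals Lra.
Open Scope R_scope.

(** Put [t = tan (B/2)], [x = cot (A/2)] and [c = AB]; these determine the
    triangle up to congruence, and every [0 < t < x], [0 < c] occurs. The two
    bisector lengths are [c] times functions of [t] and [x], so prescribing them
    amounts to one equation for [x] (the ratio of the bisectors), after which
    [c] is fixed by the scale. For fixed [t] the ratio [l_a / l_b] increases
    strictly with [x]; it tends to [t] as [x] decreases to [t] and is unbounded.
    Hence a solution [x > t] exists precisely when [t < l2 / l1], and it is
    unique. *)

(** * Dot products, cross products and collinearity *)

Definition dot (V P Q : point) : R :=
  (fst P - fst V) * (fst Q - fst V) + (snd P - snd V) * (snd Q - snd V).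

Definition cross (V P Q : point) : R :=
  (fst P - fst V) * (snd Q - snd V) - (snd P - snd V) * (fst Q - fst V).

Lemma pow2_gt_0 (x : R) : x <> 0 -> 0 < x ^ 2.
Proof. intros Hx; pose proof (Rsqr_pos_lt x Hx); unfold Rsqr in *; lra. Qed.

Lemma pdist_nonneg (P Q : point) : 0 <= pdist P Q.
Proof. apply sqrt_pos. Qed.

Lemma pdist_sqr (P Q : point) :
  pdist P Q ^ 2 = (fst P - fst Q) ^ 2 + (snd P - snd Q) ^ 2.
Proof.
  unfold pdist, dist_euc; rewrite pow2_sqrt; [unfold Rsqr; ring |].
  apply Rplus_le_le_0_compat; apply Rle_0_sqr.
Qed.

Lemma pdist_unique (P Q : point) (d : R) :
  0 <= d -> (fst P - fst Q) ^ 2 + (snd P - snd Q) ^ 2 = d ^ 2 -> pdist P Q = d.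
Proof.
  intros Hd H; rewrite <- pdist_sqr in H.
  pose proof (pdist_nonneg P Q); nra.
Qed.

Lemma pdist_sym (P Q : point) : pdist P Q = pdist Q P.
Proof.
  apply pdist_unique; [apply pdist_nonneg | rewrite pdist_sqr; ring].
Qed.

(** Serves as the Cauchy-Schwarz inequality, strict as soon as [cross] is nonzero, and recovers the
    cross product up to sign from the sides and the dot product. *)
Lemma lagrange_identity (V P Q : point) :
  (pdist V P * pdist V Q) ^ 2 = dot V P Q ^ 2 + cross V P Q ^ 2.
Proof.
  rewrite Rpow_mult_distr, !pdist_sqr; unfold dot, cross; ring.
Qed.

Lemma law_of_cosines (V P Q : point) :
  2 * dot V P Q = pdist V P ^ 2 + pdist V Q ^ 2 - pdist P Q ^ 2.
Proof. rewrite !pdist_sqr; unfold dot; ring. Qed.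

Lemma cross_neq0_pdist_pos (V P Q : point) :
  cross V P Q <> 0 -> 0 < pdist V P /\ 0 < pdist V Q.
Proof.
  intros H.
  pose proof (lagrange_identity V P Q) as HL.
  pose proof (pdist_nonneg V P); pose proof (pdist_nonneg V Q).
  assert (0 < cross V P Q ^ 2) by (apply pow2_gt_0; exact H).
  split; (apply Rnot_le_lt; intro);
    [assert (E : pdist V P = 0) by lra | assert (E : pdist V Q = 0) by lra];
    rewrite E in HL; nra.
Qed.

Lemma collinear_cross (P Q S : point) : collinear P Q S <-> cross P Q S = 0.
Proof.
  destruct P as [px py], Q as [qx qy], S as [sx sy].
  unfold collinear, cross; simpl; split.
  - intros (a & b & c & Hab & H1 & H2 & H3).
    (* Eliminating [c] and [b] from the three line equations leaves [a] times the cross product;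
       eliminating [c] and [a] leaves [b] times it. *)
    assert (Ha : a * ((qx - px) * (sy - py) - (qy - py) * (sx - px)) = 0).
    { replace (a * _) with
        ((a * qx + b * qy + c - (a * px + b * py + c)) * (sy - py)
         - (a * sx + b * sy + c - (a * px + b * py + c)) * (qy - py)) by ring.
      rewrite H1, H2, H3; ring. }
    assert (Hb : b * ((qx - px) * (sy - py) - (qy - py) * (sx - px)) = 0).
    { replace (b * _) with
        ((a * sx + b * sy + c - (a * px + b * py + c)) * (qx - px)
         - (a * qx + b * qy + c - (a * px + b * py + c)) * (sx - px)) by ring.
      rewrite H1, H2, H3; ring. }
    destruct Hab as [Hn | Hn];
      [destruct (Rmult_integral _ _ Ha) | destruct (Rmult_integral _ _ Hb)];
      tauto.
  - intros H.
    (* The line through [P] and [Q] serves unless they coincide, then the line through [P] and [S];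
       if all three coincide, the vertical line through the point. *)
    assert (Hcases : (qy - py <> 0 \/ px - qx <> 0) \/ (qy = py /\ qx = px)).
    { destruct (Req_dec qy py); [destruct (Req_dec qx px); [tauto|] |];
        left; [right | left]; lra. }
    destruct Hcases as [Hn | [-> ->]].
    + exists (qy - py), (px - qx), (- ((qy - py) * px + (px - qx) * py)).
      repeat split; [exact Hn | ring | ring | lra].
    + assert (Hcases : (sy - py <> 0 \/ px - sx <> 0) \/ (sy = py /\ sx = px)).
      { destruct (Req_dec sy py); [destruct (Req_dec sx px); [tauto|] |];
          left; [right | left]; lra. }
      destruct Hcases as [Hn | [-> ->]].
      * exists (sy - py), (px - sx), (- ((sy - py) * px + (px - sx) * py)).
        repeat split; [exact Hn | ring | ring | ring].
      * exists 1, 0, (- px); repeat split; [left; lra | ring | ring | ring].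
Qed.

Lemma triangle_cross (T : plane_triangle) :
  cross (vA T) (vB T) (vC T) <> 0 /\ cross (vB T) (vC T) (vA T) <> 0.
Proof.
  destruct T as [A B C H]; simpl; rewrite collinear_cross in H.
  split; [exact H |].
  intros E; apply H; rewrite <- E; unfold cross; ring.
Qed.

(** * Angles and the length of a bisector *)

Lemma cos_angle (P V Q : point) :
  0 < pdist V P -> 0 < pdist V Q ->
  cos (angle P V Q) = dot V P Q / (pdist V P * pdist V Q).
Proof.
  intros HP HQ; unfold angle; fold (dot V P Q).
  assert (Hpq : 0 < pdist V P * pdist V Q) by nra.
  pose proof (lagrange_identity V P Q).
  apply cos_acos; split.
  - apply Rmult_le_reg_r with (1 := Hpq); field_simplify; [nra | lra].
  - apply Rmult_le_reg_r with (1 := Hpq); field_simplify; [nra | lra].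
Qed.

(** The foot divides [PQ] in the ratio [p : q] of the adjacent sides. The equation is
    [l = 2 p q cos (V/2) / (p + q)], squared and cleared of denominators, with
    [2 cos (V/2)^2 = 1 + cos V]. *)
Lemma bisector_length_iff (V P Q : point) (l : R) :
  cross V P Q <> 0 ->
  bisector_length V P Q l <->
  0 <= l /\
  l ^ 2 * (pdist V P + pdist V Q) ^ 2 =
  2 * (pdist V P * pdist V Q) * (pdist V P * pdist V Q + dot V P Q).
Proof.
  intros Hc.
  destruct (cross_neq0_pdist_pos _ _ _ Hc) as [Hp Hq].
  pose proof (lagrange_identity V P Q) as HL.
  pose proof (pow2_gt_0 _ Hc) as Hc2.
  pose proof (pdist_sqr V P) as Hp2; pose proof (pdist_sqr V Q) as Hq2.
  set (p := pdist V P) in *; set (q := pdist V Q) in *.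
  set (m := dot V P Q) in *.
  assert (Hpq : 0 < p * q) by nra.
  assert (Hm : m < p * q) by nra.
  assert (Hm' : - m < p * q) by nra.
  assert (Hdots : forall t D,
    fst D = (1 - t) * fst P + t * fst Q ->
    snd D = (1 - t) * snd P + t * snd Q ->
    dot V P D = (1 - t) * p ^ 2 + t * m /\
    dot V D Q = (1 - t) * m + t * q ^ 2 /\
    pdist V D ^ 2 = (1 - t) ^ 2 * p ^ 2 + 2 * t * (1 - t) * m + t ^ 2 * q ^ 2).
  { intros t D H1 H2.
    rewrite pdist_sqr, Hp2, Hq2; unfold m, dot; rewrite H1, H2.
    repeat split; ring. }
  (* No point of the segment is [V], so the angles at [V] towards the foot are genuine. The
     expression equals [((1 - t) p - t q)^2 + 2 t (1 - t) (p q + m)]. *)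
  assert (Hpos : forall t,
    0 <= t <= 1 ->
    0 < (1 - t) ^ 2 * p ^ 2 + 2 * t * (1 - t) * m + t ^ 2 * q ^ 2).
  { intros t Ht.
    assert (0 <= t * (1 - t)) by nra.
    destruct (Req_dec t 0) as [-> | Ht0]; [nra |].
    destruct (Req_dec t 1) as [-> | Ht1]; [nra |].
    assert (0 < t * (1 - t)) by nra.
    assert (0 < t * (1 - t) * (p * q + m)) by nra.
    pose proof (pow2_ge_0 ((1 - t) * p - t * q)); nra. }
  split.
  - intros (D & ((t & Ht & H1 & H2) & Hang) & Hl).
    destruct (Hdots t D H1 H2) as (E1 & E2 & E3).
    specialize (Hpos t Ht); rewrite <- E3 in Hpos.
    rewrite Hl in *.
    assert (Hl0 : 0 <= l) by (rewrite <- Hl; apply pdist_nonneg).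
    assert (Hlpos : 0 < l) by nra.
    assert (Hcos : cos (angle P V D) = cos (angle D V Q)) by now rewrite Hang.
    rewrite !cos_angle in Hcos by (rewrite ?Hl; assumption).
    rewrite Hl, E1, E2 in Hcos; fold p q in Hcos.
    assert (Hcos' : q * ((1 - t) * p ^ 2 + t * m) = p * ((1 - t) * m + t * q ^ 2)).
    { apply (f_equal (fun z => z * (l * p * q))) in Hcos.
      field_simplify in Hcos; [nra | lra | lra]. }
    (* [Hcos'] factors as [((1 - t) p - t q) (p q - m) = 0], and [m < p q]. *)
    assert (Hk : (1 - t) * p = t * q).
    { apply Rmult_eq_reg_r with (p * q - m); nra. }
    assert (Ht' : t = p / (p + q)) by (field_simplify_eq; nra).
    split; [exact Hl0 |].
    rewrite E3, Ht'; field; nra.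
  - intros [Hl0 Hl].
    set (t := p / (p + q)).
    assert (Ht : 0 <= t <= 1).
    { unfold t; split; [apply Rlt_le, Rdiv_lt_0_compat; lra |].
      apply Rmult_le_reg_r with (p + q); [lra |]; field_simplify; lra. }
    set (D := ((1 - t) * fst P + t * fst Q, (1 - t) * snd P + t * snd Q)).
    destruct (Hdots t D eq_refl eq_refl) as (E1 & E2 & E3).
    specialize (Hpos t Ht); rewrite <- E3 in Hpos.
    pose proof (pdist_nonneg V D).
    exists D; split; [split |].
    + exists t; split; [exact Ht | split; reflexivity].
    + unfold angle; fold (dot V P D) (dot V D Q) p q; f_equal.
      rewrite E1, E2; unfold t; field; repeat split; nra.
    + assert (Hsq : pdist V D ^ 2 = l ^ 2).
      { apply Rmult_eq_reg_r with ((p + q) ^ 2); [| nra].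
        rewrite Hl, E3; unfold t; field; nra. }
      nra.
Qed.

(** * Congruence from three equal sides *)

(** The law of cosines gives equal dot products at [B], and Lagrange's identity then gives equal
    cross products up to a sign [s]. These are the coordinates of [C] in the frame formed by [A - B]
    and its quarter turn. *)
Lemma side_side_side (T T' : plane_triangle) :
  pdist (vB T) (vA T) = pdist (vB T') (vA T') ->
  pdist (vB T) (vC T) = pdist (vB T') (vC T') ->
  pdist (vA T) (vC T) = pdist (vA T') (vC T') ->
  congruent T T'.
Proof.
  intros Hc Ha Hb.
  destruct (triangle_cross T) as [_ HT].
  destruct T as [A B C n], T' as [A' B' C' n']; simpl in *.
  pose proof (law_of_cosines B A C) as L.
  pose proof (law_of_cosines B' A' C') as L'.
  pose proof (lagrange_identity B A C) as G.
  pose proof (lagrange_identity B' A' C') as G'.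
  assert (Hm : dot B A C = dot B' A' C') by (rewrite Hc, Ha, Hb in L; lra).
  rewrite Hc, Ha, Hm in G.
  assert (Hs : exists s, s ^ 2 = 1 /\ cross B' A' C' = s * cross B A C).
  { assert (E : (cross B' A' C' - cross B A C) * (cross B' A' C' + cross B A C) = 0)
      by nra.
    destruct (Rmult_integral _ _ E); [exists 1 | exists (-1)]; split; lra. }
  destruct Hs as (s & Hs & Hcr).
  destruct (cross_neq0_pdist_pos _ _ _ HT) as [_ Hpos].
  pose proof (pdist_sqr B A) as D; pose proof (pdist_sqr B' A') as D'.
  rewrite <- Hc in D'.
  set (c := pdist B A) in *; clearbody c; clear L L' G G' Hc Ha Hb HT.
  assert (Hc0 : c <> 0) by lra.
  (* The isometry carrying [A - B] to [A' - B'] and the quarter turn of [A - B]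
     to [s] times that of [A' - B'], where [s] compares the orientations. *)
  exists (fun P =>
    (fst B' + (dot B A P * (fst A' - fst B')
               - s * cross B A P * (snd A' - snd B')) / c ^ 2,
     snd B' + (dot B A P * (snd A' - snd B')
               + s * cross B A P * (fst A' - fst B')) / c ^ 2)).
  destruct A as [ax ay], B as [bx by_], C as [cx cy],
    A' as [ax' ay'], B' as [bx' by'], C' as [cx' cy'].
  unfold dot, cross in *; simpl fst in *; simpl snd in *.
  split; [| split; [| split]]; cbn [vA vB vC fst snd].
  - intros [p1 p2] [q1 q2].
    apply pdist_unique; [apply pdist_nonneg |].
    rewrite pdist_sqr; simpl fst; simpl snd.
    (* The map multiplies squared distances by [|AB|^2 |A'B'|^2 / c^4], which is 1. The inner form
       isolates [s ^ 2] so that it can be replaced by 1. *)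
    transitivity
      (((p1 - q1) ^ 2 + (p2 - q2) ^ 2) * ((bx - ax) ^ 2 + (by_ - ay) ^ 2)
       * ((bx' - ax') ^ 2 + (by' - ay') ^ 2) / (c ^ 2 * c ^ 2)).
    + transitivity
        (((p1 - q1) * (ax - bx) + (p2 - q2) * (ay - by_)) ^ 2
           * ((bx' - ax') ^ 2 + (by' - ay') ^ 2) / (c ^ 2 * c ^ 2)
         + s ^ 2 * ((ax - bx) * (p2 - q2) - (ay - by_) * (p1 - q1)) ^ 2
           * ((bx' - ax') ^ 2 + (by' - ay') ^ 2) / (c ^ 2 * c ^ 2));
        [field; lra | rewrite Hs; field; lra].
    + rewrite <- D, <- D'; field; lra.
  - replace ((ax - bx) * (ax - bx) + (ay - by_) * (ay - by_)) with (c ^ 2)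
      by (rewrite D; ring).
    f_equal; field; lra.
  - f_equal; field; lra.
  - rewrite Hm, <- Hcr.
    f_equal.
    + transitivity
        (bx' + (cx' - bx') * ((bx' - ax') ^ 2 + (by' - ay') ^ 2) / c ^ 2);
        [field; lra | rewrite <- D'; field; lra].
    + transitivity
        (by' + (cy' - by') * ((bx' - ax') ^ 2 + (by' - ay') ^ 2) / c ^ 2);
        [field; lra | rewrite <- D'; field; lra].
Qed.

(** * Half-angle parameters of a triangle *)

Lemma scaled_eq_iff (k u v u' v' : R) :
  k <> 0 -> u = k * u' -> v = k * v' -> u = v <-> u' = v'.
Proof.
  intros Hk -> ->; split; [| now intros ->].
  intros E; exact (Rmult_eq_reg_l k _ _ E Hk).
Qed.

(* With [t = tan (B/2)] and [x = cot (A/2)] the condition [t < x] says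
   [A + B < PI], and the two equations are the law of sines. *)
Definition has_shape (T : plane_triangle) (t x c : R) : Prop :=
  0 < t < x /\ 0 < c /\ pdist (vB T) (vA T) = c /\
  pdist (vB T) (vC T) = x * (1 + t ^ 2) * c / ((t * x + 1) * (x - t)) /\
  pdist (vA T) (vC T) = t * (1 + x ^ 2) * c / ((t * x + 1) * (x - t)).

Lemma has_shape_exists (T : plane_triangle) : exists t x c, has_shape T t x c.
Proof.
  destruct (triangle_cross T) as [H1 H2].
  destruct T as [A B C n]; unfold has_shape; simpl in *.
  destruct (cross_neq0_pdist_pos _ _ _ H1) as [_ Hb].
  destruct (cross_neq0_pdist_pos _ _ _ H2) as [Ha Hc].
  pose proof (lagrange_identity B A C) as GB.
  pose proof (lagrange_identity A B C) as GA.
  assert (Hcr : cross B A C ^ 2 = cross A B C ^ 2) by (unfold cross; ring).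
  (* [S] is twice the area, that is [a c sin B = b c sin A], while [m = a c cos B] and
     [c ^ 2 - m = b c cos A]. *)
  assert (HS : exists S, 0 < S /\ S ^ 2 = cross A B C ^ 2).
  { exists (Rabs (cross A B C)); split; [now apply Rabs_pos_lt | apply pow2_abs]. }
  destruct HS as (S & HS & HS2).
  assert (Hm : dot A B C = pdist B A ^ 2 - dot B A C)
    by (rewrite pdist_sqr; unfold dot; ring).
  rewrite Hcr, <- HS2 in GB; rewrite <- HS2, Hm, (pdist_sym A B) in GA.
  set (m := dot B A C) in *; set (a := pdist B C) in *.
  set (b := pdist A C) in *; set (c := pdist B A) in *.
  clearbody m a b c; clear - Ha Hb Hc HS GA GB.
  assert (Hac : 0 < a * c) by nra.
  assert (Hbc : 0 < b * c) by nra.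
  assert (Hp : 0 < a * c + m) by nra.
  assert (Hq : 0 < b * c + (c ^ 2 - m)) by nra.
  (* These are [tan (B/2) = sin B / (1 + cos B)] and [cot (A/2) = (1 + cos A) / sin A]. [Et'] and
     [Ex'] below are the companion forms with [1 - cos]. *)
  set (t := S / (a * c + m)); set (x := (b * c + (c ^ 2 - m)) / S).
  assert (Ht : 0 < t) by (apply Rdiv_lt_0_compat; assumption).
  assert (Hx : 0 < x) by (apply Rdiv_lt_0_compat; assumption).
  assert (Et : t * (a * c + m) = S) by (unfold t; field; lra).
  assert (Ex : b * c + (c ^ 2 - m) = x * S) by (unfold x; field; lra).
  clearbody t x.
  assert (Et' : a * c - m = t * S).
  { apply Rmult_eq_reg_r with (a * c + m); [| lra].
    replace ((a * c - m) * (a * c + m)) with ((c * a) ^ 2 - m ^ 2) by ring.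
    rewrite GB; nra. }
  assert (Ex' : x * (b * c - (c ^ 2 - m)) = S).
  { apply Rmult_eq_reg_r with S; [| lra].
    replace (x * (b * c - (c ^ 2 - m)) * S)
      with ((b * c - (c ^ 2 - m)) * (b * c + (c ^ 2 - m)))
      by (rewrite Ex; ring).
    replace ((b * c - (c ^ 2 - m)) * (b * c + (c ^ 2 - m)))
      with ((c * b) ^ 2 - (c ^ 2 - m) ^ 2) by ring.
    rewrite GA; ring. }
  (* [F1] and [F2] are the half-angle formulas for [sin B] and [sin A]. [F3] adds the two
     projections onto [AB], [m + (c ^ 2 - m) = c ^ 2]; its sign forces [t < x]. *)
  assert (F1 : 2 * t * (a * c) = S * (1 + t ^ 2)) by nra.
  assert (F2 : 2 * x * (b * c) = S * (1 + x ^ 2)) by nra.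
  assert (F3 : 2 * x * t * c ^ 2 = S * ((t * x + 1) * (x - t))) by nra.
  assert (Htx : 0 < t * x) by nra.
  assert (Hc2 : 0 < c ^ 2) by nra.
  assert (Hlt : t < x).
  { apply Rnot_le_lt; intro Hle.
    assert (0 < 2 * x * t * c ^ 2) by (apply Rmult_lt_0_compat; lra).
    assert (0 <= S * ((t * x + 1) * (t - x)))
      by (apply Rmult_le_pos; [lra | apply Rmult_le_pos; lra]).
    nra. }
  set (k := (t * x + 1) * (x - t)) in *.
  assert (Hk : 0 < k) by (apply Rmult_lt_0_compat; lra).
  assert (HSk : S * k * c <> 0)
    by (apply Rgt_not_eq, Rmult_lt_0_compat; [apply Rmult_lt_0_compat |]; assumption).
  exists t, x, c; repeat split; try assumption; fold k.
  - apply Rmult_eq_reg_r with (S * k * c); [| exact HSk].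
    transitivity (x * c ^ 2 * (S * (1 + t ^ 2))); [| field; lra].
    rewrite <- F3, <- F1; ring.
  - apply Rmult_eq_reg_r with (S * k * c); [| exact HSk].
    transitivity (t * c ^ 2 * (S * (1 + x ^ 2))); [| field; lra].
    rewrite <- F3, <- F2; ring.
Qed.

Lemma has_shape_realized (t x c : R) :
  0 < t < x -> 0 < c -> exists T, has_shape T t x c.
Proof.
  intros [Ht Hx] Hc.
  set (k := (t * x + 1) * (x - t)).
  assert (Htx : 0 < t * x) by nra.
  assert (Hk : 0 < k) by (apply Rmult_lt_0_compat; lra).
  set (A := (c, 0)); set (B := (0, 0)).
  (* [C = a (cos B, sin B)] with [a = x (1 + t^2) c / k], [cos B = (1 - t^2) / (1 + t^2)] and
     [sin B = 2 t / (1 + t^2)]. *)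
  set (C := (x * c * (1 - t ^ 2) / k, 2 * t * x * c / k)).
  assert (Hn : ~ collinear A B C).
  { rewrite collinear_cross; unfold cross, A, B, C; simpl fst; simpl snd.
    apply Rlt_not_eq, Ropp_lt_cancel; rewrite Ropp_0.
    apply Rlt_le_trans with (2 * t * x * c * c / k); [| right; field; lra].
    apply Rdiv_lt_0_compat; [| exact Hk].
    repeat apply Rmult_lt_0_compat; lra. }
  exists (PlaneTriangle A B C Hn); unfold has_shape; simpl; fold k.
  repeat split; try assumption; apply pdist_unique;
    unfold A, B, C; simpl fst; simpl snd.
  - lra.
  - ring.
  - apply Rlt_le, Rdiv_lt_0_compat; [repeat apply Rmult_lt_0_compat; nra | exact Hk].
  - field; lra.
  - apply Rlt_le, Rdiv_lt_0_compat; [repeat apply Rmult_lt_0_compat; nra | exact Hk].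
  - unfold k; field; nra.
Qed.

Lemma has_shape_congruent (T T' : plane_triangle) (t x c : R) :
  has_shape T t x c -> has_shape T' t x c -> congruent T T'.
Proof.
  intros (_ & _ & E1 & E2 & E3) (_ & _ & F1 & F2 & F3).
  apply side_side_side; congruence.
Qed.

(** * The angle at [B] and the two bisectors in these parameters *)

Lemma acos_half_angle (t : R) :
  0 < t -> acos ((1 - t ^ 2) / (1 + t ^ 2)) = 2 * atan t.
Proof.
  intros Ht.
  pose proof (atan_bound t) as [_ Hu].
  assert (Hl : 0 < atan t) by (rewrite <- atan_0; now apply atan_increasing).
  assert (Hcos : cos (2 * atan t) = (1 - t ^ 2) / (1 + t ^ 2)).
  { assert (Hc : 0 < cos (atan t)) by (apply cos_gt_0; lra).
    assert (Hs : sin (atan t) = t * cos (atan t)).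
    { rewrite <- (tan_atan t) at 2; unfold tan; field; lra. }
    pose proof (sin2_cos2 (atan t)) as H1; unfold Rsqr in H1.
    rewrite cos_2a, Hs.
    rewrite Hs in H1.
    apply Rmult_eq_reg_r with (1 + t ^ 2); [| nra].
    field_simplify; [| nra].
    nra. }
  rewrite <- Hcos; apply acos_cos; lra.
Qed.

Lemma has_shape_angle_B (T : plane_triangle) (t x c : R) :
  has_shape T t x c -> angle_B T = 2 * atan t.
Proof.
  intros ([Ht Hx] & Hc & E1 & E2 & E3).
  pose proof (law_of_cosines (vB T) (vA T) (vC T)) as L.
  rewrite <- acos_half_angle by exact Ht.
  unfold angle_B, angle; fold (dot (vB T) (vA T) (vC T)); f_equal.
  replace (dot (vB T) (vA T) (vC T)) with
    ((pdist (vB T) (vA T) ^ 2 + pdist (vB T) (vC T) ^ 2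
      - pdist (vA T) (vC T) ^ 2) / 2) by lra.
  rewrite E1, E2, E3; field; repeat split; nra.
Qed.

(** With [k = (t x + 1) (x - t)], the sides at [B] add up to [c (t x^2 + 2 x - t) / k], and
    [1 + cos B = 2 / (1 + t^2)]. The common factor [c^2 / k^2] cancels. *)
Lemma has_shape_l_b (T : plane_triangle) (t x c l : R) :
  has_shape T t x c ->
  is_l_b T l <->
  0 <= l /\ l ^ 2 * (t * x ^ 2 + 2 * x - t) ^ 2 = 4 * x ^ 2 * (1 + t ^ 2) * c ^ 2.
Proof.
  intros ([Ht Hx] & Hc & E1 & E2 & E3).
  unfold is_l_b; rewrite bisector_length_iff by apply triangle_cross.
  pose proof (law_of_cosines (vB T) (vC T) (vA T)) as L.
  replace (dot (vB T) (vC T) (vA T)) with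
    ((pdist (vB T) (vC T) ^ 2 + pdist (vB T) (vA T) ^ 2
      - pdist (vC T) (vA T) ^ 2) / 2) by lra.
  rewrite (pdist_sym (vC T)), E1, E2, E3.
  set (k := (t * x + 1) * (x - t)).
  assert (Hk : 0 < k) by (apply Rmult_lt_0_compat; nra).
  apply and_iff_compat_l, (scaled_eq_iff (c ^ 2 / k ^ 2)).
  - assert (0 < c ^ 2 / k ^ 2); [| lra].
    apply Rdiv_lt_0_compat; apply pow2_gt_0; lra.
  - unfold k; field; nra.
  - unfold k; field; nra.
Qed.

(** Here the sides at [A] add up to [c x (2 t x + 1 - t^2) / k], and
    [1 + cos A = 2 x^2 / (1 + x^2)], so the common factor is [c^2 x^2 / k^2]. *)
Lemma has_shape_l_a (T : plane_triangle) (t x c l : R) :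
  has_shape T t x c ->
  is_l_a T l <->
  0 <= l /\ l ^ 2 * (2 * t * x + 1 - t ^ 2) ^ 2 = 4 * t ^ 2 * (1 + x ^ 2) * c ^ 2.
Proof.
  intros ([Ht Hx] & Hc & E1 & E2 & E3).
  unfold is_l_a; rewrite bisector_length_iff by apply triangle_cross.
  pose proof (law_of_cosines (vA T) (vB T) (vC T)) as L.
  replace (dot (vA T) (vB T) (vC T)) with
    ((pdist (vA T) (vB T) ^ 2 + pdist (vA T) (vC T) ^ 2
      - pdist (vB T) (vC T) ^ 2) / 2) by lra.
  rewrite (pdist_sym (vA T) (vB T)), E1, E2, E3.
  set (k := (t * x + 1) * (x - t)).
  assert (Hk : 0 < k) by (apply Rmult_lt_0_compat; nra).
  apply and_iff_compat_l, (scaled_eq_iff (c ^ 2 * x ^ 2 / k ^ 2)).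
  - assert (0 < c ^ 2 * x ^ 2 / k ^ 2); [| lra].
    apply Rdiv_lt_0_compat; [apply Rmult_lt_0_compat |]; apply pow2_gt_0; lra.
  - unfold k; field; nra.
  - unfold k; field; nra.
Qed.

(** * Monotonicity and range of the ratio of the bisectors *)

(* [ratio_num t x / ratio_den t x] is [(l_a / l_b) ^ 2 * (1 + t ^ 2) / t ^ 2]. *)
Definition ratio_num (t x : R) : R := (1 + x ^ 2) * (t * x ^ 2 + 2 * x - t) ^ 2.

Definition ratio_den (t x : R) : R := x ^ 2 * (2 * t * x + 1 - t ^ 2) ^ 2.

Ltac nonneg :=
  lazymatch goal with
  | |- 0 <= _ + _ => apply Rplus_le_le_0_compat; nonneg
  | |- 0 <= _ * _ => apply Rmult_le_pos; nonneg
  | |- 0 <= _ ^ _ => apply pow_le; nonneg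
  | |- _ => lra
  end.

Ltac positive_monomial :=
  lazymatch goal with
  | |- 0 < _ * _ => apply Rmult_lt_0_compat; positive_monomial
  | |- 0 < _ ^ _ => apply pow_lt; positive_monomial
  | |- _ => lra
  end.

(** Looks for one monomial whose factors are all strictly positive and treats the others as
    nonnegative. In [ratio_increasing] only [y] may vanish, so a monomial free of [y] is needed. *)
Ltac positive :=
  lazymatch goal with
  | |- 0 < _ + _ =>
      first [ apply Rplus_le_lt_0_compat; [| positive_monomial]; nonneg
            | apply Rplus_lt_le_0_compat; [positive | nonneg] ]
  | |- _ => positive_monomial
  end.

(* In the variables [t], [y = x1 - t], [d = x2 - x1] the difference of the two
   sides is a polynomial with nonnegative coefficients. *)
Lemma ratio_increasing (t x1 x2 : R) :
  0 < t -> t <= x1 -> x1 < x2 ->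
  ratio_num t x1 * ratio_den t x2 < ratio_num t x2 * ratio_den t x1.
Proof.
  intros Ht H1 H2.
  assert (Hx : exists y d, 0 <= y /\ 0 < d /\ x1 = t + y /\ x2 = t + y + d)
    by (exists (x1 - t), (x2 - x1); repeat split; lra).
  clear H1 H2; destruct Hx as (y & d & Hy & Hd & -> & ->).
  apply Rlt_0_minus; unfold ratio_num, ratio_den; ring_simplify.
  positive.
Qed.

(* Eliminates [c] between the equations of the two bisectors. *)
Lemma has_shape_ratio (T : plane_triangle) (t x c l1 l2 : R) :
  has_shape T t x c -> is_l_a T l2 -> is_l_b T l1 ->
  l2 ^ 2 * (1 + t ^ 2) * ratio_den t x = l1 ^ 2 * t ^ 2 * ratio_num t x.
Proof.
  intros HT Ha Hb.
  apply (has_shape_l_a _ _ _ _ _ HT) in Ha as [_ Ha].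
  apply (has_shape_l_b _ _ _ _ _ HT) in Hb as [_ Hb].
  unfold ratio_num, ratio_den.
  transitivity (x ^ 2 * (1 + t ^ 2) * (l2 ^ 2 * (2 * t * x + 1 - t ^ 2) ^ 2));
    [ring | rewrite Ha].
  transitivity (t ^ 2 * (1 + x ^ 2) * (l1 ^ 2 * (t * x ^ 2 + 2 * x - t) ^ 2));
    [rewrite Hb; ring | ring].
Qed.

Lemma ratio_den_pos (t x : R) : 0 < t -> t <= x -> 0 < ratio_den t x.
Proof.
  intros Ht Hx; apply Rmult_lt_0_compat; apply pow2_gt_0; nra.
Qed.

(** At the degenerate value [x = t], where [A + B = PI], the quotient [ratio_num / ratio_den] is
    [1 + t^2], which corresponds to [l2 / l1 = t]. Monotonicity makes the ratio strictly larger for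
    [x > t]. *)
Lemma ratio_lower_bound (t x l1 l2 : R) :
  0 < l1 -> 0 < l2 -> 0 < t < x ->
  l2 ^ 2 * (1 + t ^ 2) * ratio_den t x = l1 ^ 2 * t ^ 2 * ratio_num t x ->
  t < l2 / l1.
Proof.
  intros Hl1 Hl2 [Ht Hx] H.
  pose proof (ratio_increasing t t x Ht (Rle_refl t) Hx) as Hinc.
  pose proof (ratio_den_pos t x Ht (Rlt_le _ _ Hx)) as HD.
  pose proof (ratio_den_pos t t Ht (Rle_refl t)) as HDt.
  assert (E : ratio_num t t = (1 + t ^ 2) * ratio_den t t)
    by (unfold ratio_num, ratio_den; ring).
  rewrite E in Hinc.
  assert (H3 : (1 + t ^ 2) * ratio_den t x < ratio_num t x)
    by (apply Rmult_lt_reg_r with (1 := HDt); lra).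
  assert (H4 : 0 < (1 + t ^ 2) * ratio_den t x)
    by (apply Rmult_lt_0_compat; nra).
  assert (H5 : (l1 * t) ^ 2 < l2 ^ 2).
  { apply Rmult_lt_reg_r with (1 := H4).
    replace (l2 ^ 2 * ((1 + t ^ 2) * ratio_den t x))
      with ((l1 * t) ^ 2 * ratio_num t x) by (rewrite <- Rmult_assoc, H; ring).
    apply Rmult_lt_compat_l; [apply pow2_gt_0 |]; nra. }
  apply Rmult_lt_reg_r with l1; [exact Hl1 |].
  replace (l2 / l1 * l1) with l2 by (field; lra).
  nra.
Qed.

Lemma ratio_solution_exists (t l1 l2 : R) :
  0 < l1 -> 0 < l2 -> 0 < t < l2 / l1 ->
  exists x, t < x /\
    l2 ^ 2 * (1 + t ^ 2) * ratio_den t x = l1 ^ 2 * t ^ 2 * ratio_num t x.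
Proof.
  intros Hl1 Hl2 [Ht Hr].
  set (g := fun x => l1 ^ 2 * t ^ 2 * ratio_num t x
                     - l2 ^ 2 * (1 + t ^ 2) * ratio_den t x).
  assert (Hg : continuity g)
    by (apply derivable_continuous; unfold g, ratio_num, ratio_den; reg).
  assert (Hlt : l1 * t < l2).
  { apply Rmult_lt_reg_r with (/ l1); [now apply Rinv_0_lt_compat |].
    replace (l1 * t * / l1) with t by (field; lra); exact Hr. }
  pose proof (Rmult_lt_0_compat _ _ Hl1 Ht) as Hl1t.
  assert (Hneg : g t < 0).
  { replace (g t) with
      (- ((l2 ^ 2 - (l1 * t) ^ 2) * (t ^ 2 * (1 + t ^ 2) ^ 3)))
      by (unfold g, ratio_num, ratio_den; ring).
    assert (0 < l2 ^ 2 - (l1 * t) ^ 2) by nra.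
    assert (0 < t ^ 2 * (1 + t ^ 2) ^ 3)
      by (apply Rmult_lt_0_compat; apply pow_lt; nra).
    nra. }
  (* [X] is a point where [g] is positive. Using [1 + t^2] instead of its square root keeps [K]
     rational in the data; the last summand of [g X] below compensates for the excess. *)
  set (K := l2 * (1 + t ^ 2) / l1).
  assert (HK : 0 < K)
    by (apply Rdiv_lt_0_compat; [apply Rmult_lt_0_compat |]; nra).
  assert (EK : l2 * (1 + t ^ 2) = l1 * K) by (unfold K; field; lra).
  (* Chosen so that in [p - q] the square [(t X)^2] exceeds [2 K (t X)] by [(1 + t^2) t X], which
     outweighs the remaining negative terms. *)
  set (X := (2 * K + 1 + t ^ 2) / t).
  assert (EX : t * X = 2 * K + 1 + t ^ 2) by (unfold X; field; lra).
  assert (HX : t < X) by nra.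
  assert (Hpos : 0 < g X).
  { set (p := t * (t * X ^ 2 + 2 * X - t)).
    set (q := K * (2 * t * X + 1 - t ^ 2)).
    assert (Hq : 0 < q) by (apply Rmult_lt_0_compat; nra).
    assert (Hpq : q < p).
    { assert (0 < p - q); [| lra].
      replace (p - q) with
        (t * X * (t * X) + 2 * (t * X) - t ^ 2 - K * (2 * (t * X) + 1 - t ^ 2))
        by (unfold p, q; ring).
      rewrite EX; nra. }
    assert (Hpq2 : q ^ 2 < p ^ 2) by nra.
    assert (HX2 : 0 < X ^ 2) by (apply pow2_gt_0; lra).
    replace (g X) with
      (l1 ^ 2 * ((1 + X ^ 2) * p ^ 2 - X ^ 2 * q ^ 2)
       + t ^ 2 * (1 + t ^ 2) * l2 ^ 2 * ratio_den t X).
    - apply Rplus_lt_le_0_compat.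
      + apply Rmult_lt_0_compat; [now apply pow2_gt_0, Rgt_not_eq |].
        pose proof (Rmult_lt_compat_l _ _ _ HX2 Hpq2).
        pose proof (pow2_ge_0 p); lra.
      + pose proof (ratio_den_pos t X Ht (Rlt_le _ _ HX)).
        pose proof (pow2_ge_0 t).
        apply Rmult_le_pos; [| lra].
        apply Rmult_le_pos; [apply Rmult_le_pos; lra | apply pow2_ge_0].
    - transitivity
        (l1 ^ 2 * t ^ 2 * ratio_num t X
         - (l1 * K) ^ 2 * ratio_den t X
         + t ^ 2 * (1 + t ^ 2) * l2 ^ 2 * ratio_den t X);
        [unfold ratio_num, ratio_den, p, q; ring |].
      rewrite <- EK; unfold g; ring. }
  destruct (IVT g t X Hg HX Hneg Hpos) as (x & [Hx _] & Hx0).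
  assert (x <> t) by (intros ->; lra).
  exists x; split; [lra | unfold g in Hx0; lra].
Qed.

(** * Existence, uniqueness and the admissible interval for the angle *)

Theorem mainTheorem2 (l1 l2 theta : R) (hl2 : 0 < l2) (hl : l2 <= l1) :
  (0 < theta < angle_B_max l1 l2 ->
     exists T : plane_triangle,
       (is_l_a T l2 /\ is_l_b T l1 /\ angle_B T = theta) /\
       (forall T' : plane_triangle,
          is_l_a T' l2 /\ is_l_b T' l1 /\ angle_B T' = theta ->
          congruent T T')) /\
  (~ (0 < theta < angle_B_max l1 l2) ->
     ~ exists T : plane_triangle,
         is_l_a T l2 /\ is_l_b T l1 /\ angle_B T = theta).
Proof.
  assert (hl1 : 0 < l1) by lra.
  unfold angle_B_max; split.
  - intros [Hth0 Hth].
    pose proof (atan_bound (l2 / l1)) as [_ Hmax].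
    set (t := tan (theta / 2)).
    assert (Hat : atan t = theta / 2) by (apply atan_tan; lra).
    assert (Ht : 0 < t) by (apply tan_gt_0; lra).
    assert (Htr : t < l2 / l1).
    { rewrite <- (tan_atan (l2 / l1)); apply tan_increasing; lra. }
    destruct (ratio_solution_exists t l1 l2 hl1 hl2 (conj Ht Htr)) as (x & Hx & Ex).
    set (N := t * x ^ 2 + 2 * x - t).
    assert (HN : 0 < N) by (unfold N; nra).
    assert (Hw : 0 < sqrt (1 + t ^ 2)) by (apply sqrt_lt_R0; nra).
    assert (Hw2 : sqrt (1 + t ^ 2) ^ 2 = 1 + t ^ 2) by (apply pow2_sqrt; nra).
    set (w := sqrt (1 + t ^ 2)) in *.
    (* Positive solution of the [l_b] equation [l1 N = 2 x w c]. *)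
    set (c := l1 * N / (2 * x * w)).
    assert (Hc : 0 < c) by (apply Rdiv_lt_0_compat; nra).
    assert (Ec : 4 * x ^ 2 * (1 + t ^ 2) * c ^ 2 = l1 ^ 2 * N ^ 2)
      by (unfold c; rewrite <- Hw2; field; lra).
    destruct (has_shape_realized t x c (conj Ht Hx) Hc) as [T HT].
    exists T; split; [split; [| split] |].
    + apply (has_shape_l_a _ _ _ _ _ HT); split; [lra |].
      (* After this multiplication the [l_a] equation follows from the ratio equation [Ex] and the
         [l_b] equation [Ec]. *)
      apply Rmult_eq_reg_r with (x ^ 2 * (1 + t ^ 2)); [| nra].
      transitivity (l2 ^ 2 * (1 + t ^ 2) * ratio_den t x);
        [unfold ratio_den; ring | rewrite Ex].
      transitivity (t ^ 2 * (1 + x ^ 2) * (l1 ^ 2 * N ^ 2));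
        [unfold ratio_num, N; ring | rewrite <- Ec; field].
    + apply (has_shape_l_b _ _ _ _ _ HT); split; [lra | symmetry; exact Ec].
    + rewrite (has_shape_angle_B _ _ _ _ HT), Hat; lra.
    + intros T' (Ha' & Hb' & Hth').
      destruct (has_shape_exists T') as (t' & x' & c' & HT').
      rewrite (has_shape_angle_B _ _ _ _ HT') in Hth'.
      (* The angle fixes [t']; next the ratio fixes [x'] by strict monotonicity, and finally [l_b]
         fixes the scale [c']. *)
      assert (t' = t) as -> by (unfold t; rewrite <- (tan_atan t'); f_equal; lra).
      pose proof (has_shape_ratio _ _ _ _ _ _ HT' Ha' Hb') as Ex'.
      apply (has_shape_l_b _ _ _ _ _ HT') in Hb' as [_ Hb'].
      pose proof HT' as ([_ Hx'] & Hc' & _).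
      assert (x' = x) as ->.
      { pose proof (ratio_den_pos t x Ht (Rlt_le _ _ Hx)) as HD.
        pose proof (ratio_den_pos t x' Ht (Rlt_le _ _ Hx')) as HD'.
        assert (Hcross : ratio_num t x * ratio_den t x'
                         = ratio_num t x' * ratio_den t x).
        { apply Rmult_eq_reg_l with (l1 ^ 2 * t ^ 2);
            [| apply Rmult_integral_contrapositive; split; apply pow_nonzero; lra].
          rewrite <- !Rmult_assoc, <- Ex, <- Ex'; ring. }
        destruct (Rtotal_order x' x) as [Hlt | [Heq | Hlt]]; [| exact Heq |].
        - pose proof (ratio_increasing t x' x Ht (Rlt_le _ _ Hx') Hlt); lra.
        - pose proof (ratio_increasing t x x' Ht (Rlt_le _ _ Hx) Hlt); lra. }
      assert (c' = c) as ->.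
      { fold N in Hb'; rewrite <- Ec in Hb'.
        assert (c ^ 2 = c' ^ 2); [| nra].
        apply Rmult_eq_reg_l with (4 * x ^ 2 * (1 + t ^ 2)); [exact Hb' |].
        apply Rgt_not_eq; repeat apply Rmult_lt_0_compat; nra. }
      exact (has_shape_congruent _ _ _ _ _ HT HT').
  (* Any such triangle has [0 < t < l2 / l1], and [theta = 2 * atan t] then lies in the interval. *)
  - intros Hout (T & Ha & Hb & Hth); apply Hout.
    destruct (has_shape_exists T) as (t & x & c & HT).
    rewrite (has_shape_angle_B _ _ _ _ HT) in Hth.
    pose proof (has_shape_ratio _ _ _ _ _ _ HT Ha Hb) as Ex.
    destruct HT as (Htx & _).
    pose proof (ratio_lower_bound t x l1 l2 hl1 hl2 Htx Ex) as Hr.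
    pose proof (atan_increasing _ _ Hr).
    assert (0 < atan t) by (rewrite <- atan_0; apply atan_increasing; lra).
    lra.
Qed.
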